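(* Let $X,Y$ be real locally convex topological vector spaces and let $F_1,F_2\colon X\rightrightarrows Y$ be convex set-valued mappings. Suppose that there exists $(\hat x,\hat y_1,\hat y_2)\in X\times Y\times Y$ with $(\hat x,\hat y_1)\in\mathrm{gph}(F_1)$ and $(\hat x,\hat y_2)\in\mathrm{qri}(\mathrm{gph}(F_2))$, and that $F_1$ is polyhedral. Then $$D^*(F_1+F_2)(\bar x,\bar y)(y^* )=D^*F_1(\bar x,\bar y_1)(y^* )+D^*F_2(\bar x,\bar y_2)(y^* )$$ for all $(\bar x,\bar y)\in\mathrm{gph}(F_1+F_2)$, all $y^*\in Y^*$, and all $(\bar y_1,\bar y_2)\in S(\bar x,\bar y)$, where $$S(\bar x,\bar y):=\{(\bar y_1,\bar y_2)\in Y\times Y\mid \bar y=\bar y_1+\bar y_2,\ \bar y_i\in F_i(\bar x)\text{ for }i=1,2\}.$$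
   Context: For a set-valued mapping $F\colon X\rightrightarrows Y$, $\mathrm{gph}(F):=\{(x,y)\mid y\in F(x)\}$; $F$ is convex if $\mathrm{gph}(F)$ is a convex subset of $X\times Y$. The sum is $(F_1+F_2)(x):=\{y_1+y_2\mid y_1\in F_1(x),\ y_2\in F_2(x)\}$. A subset $P$ of a locally convex space $Z$ is a convex polyhedron if $P=\{z\in Z\mid\langle z_i^*,z\rangle\le\alpha_i,\ i=1,\dots,k\}$ for finitely many $z_i^*\in Z^*$, $\alpha_i\in\mathbb{R}$; $F$ is polyhedral if $\mathrm{gph}(F)$ is a convex polyhedron in $X\times Y$. For a convex set $\Omega$, $\mathrm{qri}(\Omega):=\{x\in\Omega\mid\overline{\mathrm{cone}(\Omega-x)}\text{ is a linear subspace}\}$, where $\mathrm{cone}(A):=\{ta\mid t\ge0,\ a\in A\}$. The normal cone to a convex set $\Omega$ at $\bar x\in\Omega$ is $N(\bar x;\Omega):=\{x^*\mid\langle x^*,x-\bar x\rangle\le0\text{ for all }x\in\Omega\}$. For $(\bar x,\bar y)\in\mathrm{gph}(F)$, the coderivative is $D^*F(\bar x,\bar y)(y^* ):=\{x^*\in X^*\mid(x^*,-y^* )\in N((\bar x,\bar y);\mathrm{gph}(F))\}$ for $y^*\in Y^*$. *)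

(* Defs.v *)
From HB Require Import structures.
From mathcomp Require Import all_boot all_order all_algebra.
From mathcomp Require Import all_classical all_reals all_analysis.

Set Implicit Arguments.
Unset Strict Implicit.
Unset Printing Implicit Defensive.

Import Order.TTheory GRing.Theory Num.Theory.
Import numFieldNormedType.Exports.

Local Open Scope classical_set_scope.
Local Open Scope ring_scope.

Definition minkowski_sum (V : nmodType) (A B : set V) : set V :=
  [set a + b | a in A & b in B].

(* [Z^*] is represented by the set of those plain functions [Z -> R] that are
   linear and continuous, so that equality and addition of functionals are
   those of functions. *)
Definition dual (R : realType) (Z : tvsType R) : set (Z -> R^o) :=
  [set f | linear f /\ continuous f].

Definition conic (R : realType) (Z : tvsType R) (A : set Z) : set Z :=
  [set t *: a | t in [set t : R | 0 <= t] & a in A].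

Definition linear_subspace (R : realType) (Z : tvsType R) (A : set Z) : Prop :=
  submod_closed (mem A).

Definition qri (R : realType) (Z : tvsType R) (Omega : set Z) : set Z :=
  [set x | Omega x /\
    linear_subspace (closure (conic [set z - x | z in Omega]))].

Definition polyhedron (R : realType) (Z : tvsType R) (P : set Z) : Prop :=
  exists (k : nat) (zstar : 'I_k -> Z -> R^o) (alpha : 'I_k -> R),
    (forall i, dual (zstar i)) /\
    P = [set z | forall i, zstar i z <= alpha i].

Definition normal_cone (R : realType) (Z : tvsType R) (xbar : Z)
    (Omega : set Z) : set (Z -> R^o) :=
  [set xstar | dual xstar /\ forall x, Omega x -> xstar (x - xbar) <= 0].

(* A set-valued mapping from [X] to [Y] is a function [X -> set Y]. *)
Definition gph (X Y : Type) (F : X -> set Y) : set (X * Y) :=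
  [set xy | F xy.1 xy.2].

Definition convex_map (R : realType) (X Y : tvsType R) (F : X -> set Y) : Prop :=
  convex_set (gph F : set (convex_lmodType (X * Y)%type)).

Definition polyhedral (R : realType) (X Y : tvsType R) (F : X -> set Y) : Prop :=
  polyhedron (gph F).

Definition map_sum (X : Type) (Y : nmodType) (F1 F2 : X -> set Y) : X -> set Y :=
  fun x => minkowski_sum (F1 x) (F2 x).

(* [(X * Y)^*] is identified with the product of the duals as usual: the pair
   [(xstar, ystar)] acts by [(x, y) |-> xstar x + ystar y]. *)
Definition pair_functional (R : realType) (X Y : tvsType R)
    (xstar : X -> R^o) (ystar : Y -> R^o) : X * Y -> R^o :=
  fun xy => xstar xy.1 + ystar xy.2.

Definition coderivative (R : realType) (X Y : tvsType R) (F : X -> set Y)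
    (xbar : X) (ybar : Y) (ystar : Y -> R^o) : set (X -> R^o) :=
  [set xstar | dual xstar /\
    normal_cone (xbar, ybar) (gph F) (pair_functional xstar (- ystar))].

Definition decompositions (X : Type) (Y : nmodType) (F1 F2 : X -> set Y)
    (xbar : X) (ybar : Y) : set (Y * Y) :=
  [set y | ybar = y.1 + y.2 /\ F1 xbar y.1 /\ F2 xbar y.2].

(* Main.v *)
Require Import Defs.
From HB Require Import structures.
From mathcomp Require Import all_boot all_order all_algebra.
From mathcomp Require Import all_classical all_reals all_analysis.
From mathcomp Require Import ring lra.

(** The inclusion from right to left adds two inequalities. For the converse,
    let [xs] belong to the coderivative of the sum. Then the affine function
    [f (x, y1, y2) = xs (x - xb) - ys (y1 - y1b) - ys (y2 - y2b)] is
    nonpositive on the points of [(X * Y) * Y] with [y1] in [F1 x] and [y2] in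
    [F2 x]. The second condition defines a convex set [C], the first one is a
    finite system of affine inequalities [g i <= 0]. If there are Lagrange
    multipliers, that is [lam i >= 0] with [f <= \sum_i lam i * g i] on [C],
    then, [y1] being free in [C], comparing the coefficients of [y1] shows that
    the linear part of the right-hand side is [(zeta (-, 0), - ys)] on [X * Y];
    so [zeta (-, 0)] is in the coderivative of [F1], by complementary slackness
    at [(xb, y1b)], and [xs - zeta (-, 0)] is in the coderivative of [F2].

    The multipliers come from [polyhedral_multipliers], a Lagrange duality
    theorem for affine constraints that hold, perhaps with equality, at a point
    of [relative_interior A C]: every function of the space [A] that is maximal
    over [C] at this point is constant on [C]. Quasi-relative interior points
    have this property for the continuous affine functions
    ([qri_relative_interior]), because the closed cone of directions lies in the
    half-space given by the maximized functional, and a linear subspace inside a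
    half-space lies in its boundary. The property moreover
    passes from the graph of [F2] to the cylinder [C]
    ([relative_interior_preimage]).

    The duality theorem is proved by induction on the number of constraints; a
    single constraint has a supremum of slopes as its multiplier. Let [g] be the
    last constraint. If some feasible point has [g < 0], the reference point can
    be moved towards it so that it satisfies [g < 0] and lies in the relative
    interior of [C] cut by [g <= 0]; the induction hypothesis on this set leaves
    one constraint with a Slater point. Otherwise [- g <= 0] is a consequence of the
    other constraints, and the induction hypothesis applied to [- g] gives a
    nonnegative combination of the constraints, with coefficient one for [g],
    that is nonnegative on [C]. It is nonpositive at the reference point, hence
    zero on [C]. So [g] may be treated as an equality constraint, whose
    multiplier may have any sign: adding a multiple of the vanishing
    combination makes it nonnegative. *)

Set Implicit Arguments.
Unset Strict Implicit.
Unset Printing Implicit Defensive.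

Import Order.TTheory GRing.Theory Num.Theory.
Import numFieldNormedType.Exports.

Local Open Scope classical_set_scope.
Local Open Scope ring_scope.

(** * Lagrange multipliers for finitely many affine constraints *)

Section Multipliers.
Variables (R : realType) (Z : lmodType R).
Implicit Types (C : set Z) (f g h : Z -> R) (z w : Z).

(** Convexity with a plain real parameter, which lets the weight of a point be
    computed from the values of a function. *)
Definition segment_closed C := forall (t : R) z w,
  0 <= t <= 1 -> C z -> C w -> C (t *: z + (1 - t) *: w).

Definition affine f := forall (t : R) z w,
  f (t *: z + (1 - t) *: w) = t * f z + (1 - t) * f w.

Definition affine_space (A : set (Z -> R)) :=
  [/\ A `<=` affine, A (fun=> 1) &
      forall (c : R) f g, A f -> A g -> A (fun z => c * f z + g z)].

(** When [Z] has finite dimension and [A] consists of all affine functions, this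
    is the usual relative interior of a convex set, by separation. In this form
    it speaks of the functions of [A] alone, and so applies directly to
    combinations of constraints. *)
Definition relative_interior (A : set (Z -> R)) C : set Z :=
  [set z0 | C z0 /\ forall h, A h ->
    (forall z, C z -> h z <= h z0) -> forall z, C z -> h z = h z0].

Lemma segment_closed_eq0 C g : segment_closed C -> affine g ->
  segment_closed (C `&` [set z | g z = 0]).
Proof.
move=> cC ag t z w t01 [Cz gz] [Cw gw]; split; first exact: cC.
by rewrite /= ag gz gw !mulr0 addr0.
Qed.

Lemma segment_closed_le0 C g : segment_closed C -> affine g ->
  segment_closed (C `&` [set z | g z <= 0]).
Proof.
move=> cC ag t z w t01 [Cz /= gz] [Cw /= gw]; split; first exact: cC.
by rewrite /= ag; nra.
Qed.

(** The segment from a point with [g < 0] to one with [g > 0] meets [g = 0],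
    where [f <= 0]. So each slope [f / g] on the positive side is at most each
    slope on the negative side, and any number in between is a multiplier. *)
Lemma multiplier_two_signs C f g : segment_closed C -> affine f -> affine g ->
  (exists2 z, C z & g z < 0) -> (exists2 z, C z & 0 < g z) ->
  (forall z, C z -> g z = 0 -> f z <= 0) ->
  exists c, forall z, C z -> f z <= c * g z.
Proof.
move=> cC af ag [z1 Cz1 g1] [z2 Cz2 g2] f0.
have slope z w : C z -> C w -> g z < 0 -> 0 < g w -> f w / g w <= f z / g z.
  move=> Cz Cw gz gw.
  have d0 : 0 < g w - g z by lra.
  (* The zero of [g] on the segment has weight [t] on [w]. *)
  pose t := - g z / (g w - g z).
  have tE : t * (g w - g z) = - g z by rewrite /t mulfVK// gt_eqF.
  have t01 : 0 <= t <= 1.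
    apply/andP; split; first by rewrite /t divr_ge0//; lra.
    by rewrite /t ler_pdivrMr//; lra.
  have := f0 _ (cC _ _ _ t01 Cw Cz).
  rewrite af ag => /(_ _)/wrap[]; first by lra.
  move=> H.
  rewrite ler_pdivrMr// mulrAC -[_ / g z]opprK -mulrN -invrN lerNr.
  rewrite ler_pdivrMr; last by lra.
  have : (t * f w + (1 - t) * f z) * (g w - g z) <= 0 by nra.
  have -> : (t * f w + (1 - t) * f z) * (g w - g z) =
    t * (g w - g z) * f w + (g w - g z - t * (g w - g z)) * f z by ring.
  by rewrite tE; nra.
pose S := [set f z / g z | z in C `&` [set z | 0 < g z]].
have ubS z : C z -> g z < 0 -> ubound S (f z / g z).
  by move=> Cz gz _ [w [Cw gw] <-]; exact: slope.
have supS : has_sup S.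
  by split; [exists (f z2 / g z2), z2 | exists (f z1 / g z1); exact: ubS].
exists (sup S) => z Cz.
have [gz|gz|gz] := ltgtP (g z) 0.
- rewrite -ler_ndivlMr//.
  by apply: ge_sup; [exact: supS.1|exact: ubS].
- rewrite -ler_pdivrMr//.
  by apply: ub_le_sup; [exact: supS.2|exists z].
- by rewrite gz mulr0; exact: f0.
Qed.

Variable A : set (Z -> R).
Hypothesis spA : affine_space A.

Lemma affine_spaceN h : A h -> A (fun z => - h z).
Proof.
case: spA => _ A1 AD Ah; have := AD (-1) _ _ A1 A1; have := AD (-1) _ _ Ah.
move=> /[apply]; congr (A _); apply/funext => z; lra.
Qed.

Lemma affine_space_sub_sum k (lam : nat -> R) (g : 'I_k -> Z -> R) f :
  (forall i, A (g i)) -> A f -> A (fun z => f z - \sum_(i < k) lam i * g i z).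
Proof.
elim: k g f => [|k IH] g f Ag Af.
  by move: Af; congr (A _); apply/funext => z; rewrite big_ord0 subr0.
have [_ _ AD] := spA.
have := IH _ _ (fun i => Ag (widen_ord (leqnSn k) i))
  (AD (- lam k) _ _ (Ag ord_max) Af).
by congr (A _); apply/funext => z; rewrite big_ord_recr/=; ring.
Qed.

(** If [g] does not take both signs on [C], then [z0] maximizes [g] or [- g],
    so [g] vanishes on [C] and any multiplier will do. *)
Lemma multiplier_eq0 C f g z0 : segment_closed C -> A f -> A g ->
  relative_interior A C z0 -> g z0 = 0 ->
  (forall z, C z -> g z = 0 -> f z <= 0) ->
  exists c, forall z, C z -> f z <= c * g z.
Proof.
move=> cC Af Ag [Cz0 ri] g0 f0.
have gV : (forall z, C z -> g z = 0) ->
    exists c, forall z, C z -> f z <= c * g z.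
  by move=> gC; exists 0 => z Cz; rewrite mul0r f0// gC.
have [gpos|gpos] := pselect (exists2 z, C z & 0 < g z); last first.
  apply: gV; rewrite -g0; apply: ri => // z Cz; rewrite g0 leNgt.
  by apply/negP => gz; apply: gpos; exists z.
have [gneg|gneg] := pselect (exists2 z, C z & g z < 0); last first.
  apply: gV => z Cz; apply: oppr_inj; rewrite -[in RHS]g0.
  apply: (ri (fun z => - g z)) => //; first exact: affine_spaceN.
  move=> w Cw; rewrite g0 oppr0 oppr_le0 leNgt.
  by apply/negP => gw; apply: gneg; exists w.
have [Aaff _ _] := spA.
by apply: multiplier_two_signs => //; exact: Aaff.
Qed.

(** If [h] is maximal at [z0] under the constraint [g = 0], then [h - c * g] is
    maximal at [z0] over [C] for a multiplier [c], hence constant on [C]. *)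
Lemma relative_interior_eq0 C g z0 : segment_closed C -> A g ->
  relative_interior A C z0 -> g z0 = 0 ->
  relative_interior A (C `&` [set z | g z = 0]) z0.
Proof.
move=> cC Ag riz0 g0; have [Cz0 ri] := riz0; split=> [|h Ah hmax].
  by split.
have [_ A1 AD] := spA.
have [c hc] : exists c, forall z, C z -> h z - h z0 <= c * g z.
  apply: (@multiplier_eq0 _ _ _ z0) => //.
  - have := AD (- h z0) _ _ A1 Ah.
    by congr (A _); apply/funext => z; lra.
  - by move=> z Cz gz; rewrite subr_le0; exact: hmax.
move=> z [Cz gz].
have Ahc : A (fun z => - c * g z + h z) by exact: AD.
have := ri _ Ahc _ z Cz; rewrite g0 gz !mulr0 !add0r; apply => w Cw.
by have := hc w Cw; lra.
Qed.

(** A function that is maximal at an interior point of the segment is maximal at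
    both ends, in particular at [z0]. *)
Lemma relative_interior_mix C z0 z1 (t : R) : segment_closed C ->
  relative_interior A C z0 -> C z1 -> 0 < t <= 1 ->
  relative_interior A C (t *: z0 + (1 - t) *: z1).
Proof.
move=> cC [Cz0 ri] Cz1 /andP[t0 t1].
split; first by apply: cC => //; rewrite ltW.
move=> h Ah; have [/(_ _ Ah)ah _ _] := spA; rewrite ah => hmax z Cz.
have h0 := hmax _ Cz0; have h1 := hmax _ Cz1.
have hE : h z0 = t * h z0 + (1 - t) * h z1.
  by nra.
by rewrite -hE; apply: ri => // w Cw; rewrite hE; exact: hmax.
Qed.

(** Near [z0], the constraint [g <= 0] does not cut [C]: each point of [C] has a
    point of the smaller set, other than [z0], on its segment to [z0], and an
    affine function that is larger at the end than at [z0] is already larger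
    there. *)
Lemma relative_interior_lt0 C g z0 : segment_closed C -> A g ->
  relative_interior A C z0 -> g z0 < 0 ->
  relative_interior A (C `&` [set z | g z <= 0]) z0.
Proof.
move=> cC Ag [Cz0 ri] g0; split; first by split=> //=; exact: ltW.
move=> h Ah hmax z [Cz _]; apply: ri => // w Cw.
have [Aaff _ _] := spA.
have [gw|gw] := leP (g w) 0; first exact: hmax.
have d0 : 0 < g w - g z0 by lra.
pose t := - g z0 / (g w - g z0).
have t0 : 0 < t by rewrite /t divr_gt0//; lra.
have tE : t * (g w - g z0) = - g z0 by rewrite /t mulfVK// gt_eqF.
have t1 : t <= 1 by rewrite /t ler_pdivrMr//; lra.
have := hmax (t *: w + (1 - t) *: z0) _; rewrite (Aaff _ Ah) => /(_ _)/wrap[].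
  split; first by apply: cC => //; rewrite ltW.
  by rewrite /= (Aaff _ Ag); lra.
by nra.
Qed.

Lemma multiplier_slater C f g z0 : segment_closed C -> A f -> A g ->
  C z0 -> g z0 < 0 -> (forall z, C z -> g z <= 0 -> f z <= 0) ->
  exists2 c, 0 <= c & forall z, C z -> f z <= c * g z.
Proof.
move=> cC Af Ag Cz0 g0 f0; have [Aaff _ _] := spA.
have [gpos|gpos] := pselect (exists2 z, C z & 0 < g z); last first.
  exists 0 => // z Cz; rewrite mul0r; apply: f0 => //; rewrite leNgt.
  by apply/negP => gz; apply: gpos; exists z.
have gneg : exists2 z, C z & g z < 0 by exists z0.
have [z Cz gz|c fc] :=
    multiplier_two_signs cC (Aaff _ Af) (Aaff _ Ag) gneg gpos.
  by apply: f0; rewrite // gz.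
have [c0|c0] := leP 0 c; first by exists c.
(* If the multiplier is negative, then [f <= 0] on all of [C]. *)
exists 0 => // z Cz; rewrite mul0r.
have [gz|gz] := leP (g z) 0; first exact: f0.
by have := fc z Cz; nra.
Qed.

(** The induction removes the last constraint [gk] by restricting [C]. If a
    feasible point has [gk < 0], the restriction is to [gk <= 0]; if none has,
    [gk] vanishes at all feasible points, which in general are not in the relative
    interior of [C] cut by [gk <= 0], and the restriction is to [gk = 0]. *)
Theorem polyhedral_multipliers k (g : 'I_k -> Z -> R) C f z0 :
  segment_closed C -> (forall i, A (g i)) -> A f ->
  relative_interior A C z0 -> (forall i, g i z0 <= 0) ->
  (forall z, C z -> (forall i, g i z <= 0) -> f z <= 0) ->
  exists2 lam : nat -> R, (forall i, 0 <= lam i) &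
    forall z, C z -> f z <= \sum_(i < k) lam i * g i z.
Proof.
have [Aaff _ _] := spA.
elim: k g C f z0 => [|k IH] g C f z0 cC Ag Af riz0 gz0 fle.
  exists (fun=> 0) => // z Cz; rewrite big_ord0; apply: fle => //.
  by case.
pose gk := g ord_max; pose g' i := g (widen_ord (leqnSn k) i).
have Ag' i : A (g' i) by exact: Ag.
have Agk : A gk by exact: Ag.
have feasible z : (forall i, g' i z <= 0) -> gk z <= 0 -> forall i, g i z <= 0.
  move=> g'z gkz i; case: (unliftP ord_max i) => [j ->|->//].
  have -> : lift ord_max j = widen_ord (leqnSn k) j by apply/val_inj/lift_max.
  exact: g'z.
have extend (lam : nat -> R) c : (forall i, 0 <= lam i) -> 0 <= c ->
    (forall z, C z -> f z <= \sum_(i < k) lam i * g' i z + c * gk z) ->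
    exists2 lam : nat -> R, (forall i, 0 <= lam i) &
      forall z, C z -> f z <= \sum_(i < k.+1) lam i * g i z.
  move=> lam0 c0 flam; exists (fun i => if (i < k)%N then lam i else c).
    by move=> i; case: ifP.
  move=> z Cz; rewrite big_ord_recr/= ltnn.
  by under eq_bigr do rewrite ltn_ord; exact: flam.
(* If some feasible point makes the last constraint strict, so does the
   midpoint [z2], which is still in the relative interior. *)
have [[z1 [Cz1 gz1 gk1]]|nostrict] :=
    pselect (exists z, [/\ C z, forall i, g i z <= 0 & gk z < 0]).
  pose z2 := 2^-1 *: z0 + (1 - 2^-1) *: z1.
  have g2 h : A h -> h z2 = 2^-1 * h z0 + (1 - 2^-1) * h z1.
    by move=> Ah; rewrite (Aaff _ Ah).
  have gk2 : gk z2 < 0 by rewrite g2//; have := gz0 ord_max; rewrite -/gk; lra.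
  have riz2 : relative_interior A C z2.
    by apply: relative_interior_mix => //; lra.
  have [||i|z [Cz gkz] g'z|lam lam0 flam] :=
      IH g' (C `&` [set z | gk z <= 0]) f z2 _ Ag' Af.
  - exact: segment_closed_le0 (Aaff _ Agk).
  - exact: relative_interior_lt0.
  - rewrite g2//; have := gz0 (widen_ord (leqnSn k) i).
    by have := gz1 (widen_ord (leqnSn k) i); rewrite -/(g' i); lra.
  - by apply: fle => //; exact: feasible.
  pose F z := f z - \sum_(i < k) lam i * g' i z.
  have [||z Cz gkz|c c0 Fc] := @multiplier_slater C F gk z2 cC _ Agk _ gk2.
  - exact: affine_space_sub_sum.
  - exact: riz2.1.
  - by rewrite /F subr_le0; exact: flam.
  apply: (extend lam c) => // z Cz.
  by have := Fc z Cz; rewrite /F; lra.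
(* Otherwise the other constraints imply [gk >= 0]. *)
have [||||mu mu0 gmu] := IH g' C (fun z => - gk z) z0 cC Ag'.
- exact: affine_spaceN.
- exact: riz0.
- by move=> i; exact: gz0.
- move=> z Cz g'z; rewrite oppr_le0 leNgt; apply/negP => gkz; apply: nostrict.
  by exists z; split => //; apply: feasible => //; exact: ltW.
pose H z := - gk z - \sum_(i < k) mu i * g' i z.
have AH : A H by apply: affine_space_sub_sum => //; exact: affine_spaceN.
have sum0 (lam : nat -> R) z : (forall i, 0 <= lam i) ->
    (forall i, g' i z <= 0) -> \sum_(i < k) lam i * g' i z <= 0.
  by move=> lam0 g'z; apply: sumr_le0 => i _; rewrite mulr_ge0_le0.
have gkz0 : gk z0 <= 0 by exact: gz0.
have Sz0 : \sum_(i < k) mu i * g' i z0 <= 0 by apply: sum0 => // i; exact: gz0.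
have [Cz0 ri] := riz0.
have Hz0 : H z0 = 0.
  by have := gmu z0 Cz0; rewrite /H; lra.
have HC z : C z -> H z = 0.
  move=> Cz; rewrite -Hz0; apply: ri => // w Cw.
  by rewrite Hz0 /H; have := gmu w Cw; lra.
have gk0 : gk z0 = 0 by move: Hz0; rewrite /H; lra.
have [||i|z [Cz gkz] g'z|lam lam0 flam] :=
    IH g' (C `&` [set z | gk z = 0]) f z0 _ Ag' Af.
- exact: segment_closed_eq0 (Aaff _ Agk).
- exact: relative_interior_eq0.
- exact: gz0.
- by apply: fle => //; apply: feasible; rewrite // gkz.
pose F z := f z - \sum_(i < k) lam i * g' i z.
have [|z Cz gkz|c Fc] := @multiplier_eq0 C F gk z0 cC _ Agk riz0 gk0.
- exact: affine_space_sub_sum.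
- by rewrite /F subr_le0; exact: flam.
(* Adding [M] times the combination that vanishes on [C] corrects the sign of
   the multiplier of [gk]. *)
have [M M0 cM] : exists2 M, 0 <= M & 0 <= c + M.
  by exists `|c|; rewrite // -lerBlDl sub0r -normrN ler_norm.
apply: (extend (fun i => lam i + M * mu i) (c + M)) => //.
  by move=> i; rewrite addr_ge0// mulr_ge0.
move=> z Cz; under eq_bigr do rewrite mulrDl -mulrA.
rewrite big_split/= -mulr_sumr.
have -> : \sum_(i < k) mu i * g' i z = - gk z.
  by have := HC z Cz; rewrite /H; lra.
by have := Fc z Cz; rewrite /F; lra.
Qed.

End Multipliers.

(** * Continuous affine functionals and the quasi-relative interior *)

Section Dual.
Variables (R : realType) (Z W : tvsType R).

Lemma dual_linear (f : Z -> R^o) : dual f ->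
  exists F : {linear Z -> R^o}, f = F.
Proof.
move=> [lf _]; pose F : {linear Z -> R^o} :=
  HB.pack f (GRing.isLinear.Build R Z R^o *:%R f lf).
by exists F.
Qed.

Lemma dualD (f : Z -> R^o) (df : dual f) z w : f (z + w) = f z + f w.
Proof. by case/dual_linear: df => F ->; rewrite linearD. Qed.

Lemma dualB (f : Z -> R^o) (df : dual f) z w : f (z - w) = f z - f w.
Proof. by case/dual_linear: df => F ->; rewrite linearB. Qed.

Lemma dualNz (f : Z -> R^o) (df : dual f) z : f (- z) = - f z.
Proof. by case/dual_linear: df => F ->; rewrite linearN. Qed.

Lemma dualZ (f : Z -> R^o) (df : dual f) c z : f (c *: z) = c * f z.
Proof. by case/dual_linear: df => F ->; rewrite linearZ. Qed.

Lemma dual0 (f : Z -> R^o) (df : dual f) : f 0 = 0.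
Proof. by case/dual_linear: df => F ->; rewrite linear0. Qed.

Lemma dual_zero : dual (fun _ : Z => 0 : R^o).
Proof.
split; first by move=> c z w; rewrite scaler0 addr0.
by move=> z; exact: cvg_cst.
Qed.

Lemma dual_comb (c : R) (f g : Z -> R^o) : dual f -> dual g ->
  dual (fun z => c * f z + g z : R^o).
Proof.
move=> df dg; split.
  move=> a z w; rewrite !(dualD df, dualZ df, dualD dg, dualZ dg).
  rewrite /GRing.scale/=; ring.
case: df dg => [_ cf] [_ cg] z.
by apply: cvgD; [apply: cvgMl_tmp; exact: cf | exact: cg].
Qed.

Lemma dual_comp (T : W -> Z) (f : Z -> R^o) :
  linear T -> continuous T -> dual f -> dual (f \o T).
Proof.
move=> lT cT [lf cf]; split; first by move=> a z w /=; rewrite lT lf.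
by move=> z; apply: continuous_comp; [exact: cT|exact: cf].
Qed.

End Dual.

Section AffineFunctionals.
Variables (R : realType).
Implicit Types Z W : tvsType R.

Definition affine_functionals Z : set (Z -> R) :=
  [set h | exists2 f : Z -> R^o, dual f & exists a : R, h = fun z => f z + a].

Lemma affine_space_functionals Z : affine_space (@affine_functionals Z).
Proof.
split.
- move=> h [f df [a ->]] t z w /=; rewrite (dualD df) !(dualZ df); ring.
- exists (fun=> 0); first exact: dual_zero.
  by exists 1; apply/funext => z; rewrite add0r.
- move=> c _ _ [f df [a ->]] [g dg [b ->]].
  exists (fun z => c * f z + g z); first exact: dual_comb.
  by exists (c * a + b); apply/funext => z; ring.
Qed.

(** A functional that is maximal over [C] at [z0] is nonpositive on the closed
    cone generated by [C - z0]; when this cone is a subspace, it also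
    contains [- (z - z0)] for [z] in [C], so the functional vanishes there. *)
Lemma qri_relative_interior Z (C : set Z) :
  qri C `<=` relative_interior (@affine_functionals Z) C.
Proof.
move=> z0 [Cz0 [_ sub]]; split=> // _ [f df [a ->]] fmax z Cz.
have cone_le : closure (conic [set z - z0 | z in C]) `<=` [set z | f z <= 0].
  have cl : closed [set z | f z <= 0].
    have -> : [set z | f z <= 0] = f @^-1` [set r : R^o | r <= 0] by [].
    by apply: preimage_closed; [move=> ? _; exact: df.2|exact: closed_le].
  rewrite [X in _ `<=` X](closure_id _).1//; apply: closureS.
  move=> _ [t /= t0 [_ [w Cw <-] <-]] /=.
  rewrite (dualZ df) mulr_ge0_le0// (dualB df) subr_le0.
  by have := fmax w Cw; rewrite lerD2r.
have inC : closure (conic [set z - z0 | z in C]) (z - z0).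
  apply: subset_closure; exists 1 => //=; exists (z - z0); first by exists z.
  by rewrite scale1r.
have in0 : closure (conic [set z - z0 | z in C]) 0.
  apply: subset_closure; exists 0 => //=; exists (z - z0); first by exists z.
  by rewrite scale0r.
have inN : closure (conic [set z - z0 | z in C]) (- (z - z0)).
  have := sub (-1) (z - z0) 0; rewrite scaleN1r addr0 => h.
  by apply/set_mem/h; apply/mem_set.
have := cone_le _ inN; have := cone_le _ inC.
by rewrite /= opprB !(dualB df); lra.
Qed.

(** A functional that is bounded above on a fiber of [T] vanishes on the kernel
    of [T]; the section [s] shows that it factors through [T] as a
    continuous functional. *)
Lemma relative_interior_preimage Z W (T : Z -> W) (s : W -> Z) (C : set W) z0 :
  linear T -> linear s -> continuous s -> cancel s T ->
  relative_interior (@affine_functionals W) C (T z0) ->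
  relative_interior (@affine_functionals Z) (T @^-1` C) z0.
Proof.
move=> lT ls cs sK [Cz0 ri]; split=> // _ [f df [a ->]] fmax.
have TB z w : T (z - w) = T z - T w.
  by rewrite addrC -scaleN1r lT scaleN1r addrC.
have TD z w : T (z + w) = T z + T w.
  by rewrite -[z]scale1r lT !scale1r.
have ker u : T u = 0 -> f u = 0.
  move=> Tu; have := fmax (z0 + u) _; have := fmax (z0 - u) _.
  rewrite /= TB TD Tu subr0 addr0 (dualB df) (dualD df) => /(_ Cz0).
  by move=> + /(_ Cz0); lra.
have fE z : f z = f (s (T z)).
  apply/eqP; rewrite -subr_eq0 -(dualB df); apply/eqP/ker.
  by rewrite TB sK subrr.
move=> z Cz; rewrite (fE z) (fE z0).
have Afs : affine_functionals (fun w => f (s w) + a).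
  by exists (f \o s); [exact: dual_comp|exists a].
apply: (ri _ Afs _ (T z) Cz) => w Cw.
by rewrite -fE; apply: fmax; rewrite /= sK.
Qed.

End AffineFunctionals.

(** * Continuous functionals on products *)

Lemma dual_sum (R : realType) (Z : tvsType R) k (lam : nat -> R)
    (f : 'I_k -> Z -> R^o) : (forall i, dual (f i)) ->
  dual (fun z => \sum_(i < k) lam i * f i z : R^o).
Proof.
elim: k f => [|k IH] f df.
  by under eq_fun do rewrite big_ord0; exact: dual_zero.
under eq_fun do rewrite big_ord_recr /= addrC.
by apply: dual_comb; [exact: df|exact: IH].
Qed.

Lemma continuous_pair (U V W : topologicalType) (f : U -> V) (g : U -> W) :
  continuous f -> continuous g -> continuous (fun u => (f u, g u)).
Proof. by move=> cf cg u; apply: cvg_pair; [exact: cf|exact: cg]. Qed.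

Section Product.
Variables (R : realType) (X Y : tvsType R).

Lemma dual_pairl (f : X * Y -> R^o) : dual f -> dual (fun x => f (x, 0)).
Proof.
move=> df; apply: (@dual_comp _ _ _ (fun x : X => (x, 0 : Y))) => //.
  by move=> a x y; rewrite -[RHS]/(_, _)/= scaler0 addr0.
by apply: continuous_pair => x; [exact: cvg_id|exact: cvg_cst].
Qed.

Lemma dual_pair_functional (f : X -> R^o) (g : Y -> R^o) :
  dual f -> dual g -> dual (pair_functional f g).
Proof.
move=> df dg.
have := dual_comb 1 (@dual_comp _ _ _ (fst : X * Y -> X) _ _ _ df)
  (@dual_comp _ _ _ (snd : X * Y -> Y) _ _ _ dg).
under eq_fun do rewrite mul1r.
by apply => // z; [exact: cvg_fst|exact: cvg_snd].
Qed.

Lemma dualN (f : Y -> R^o) : dual f -> dual (- f).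
Proof.
move=> df; have := dual_comb (-1) df (dual_zero Y).
by congr dual; apply/funext => y; rewrite addr0 mulN1r.
Qed.

End Product.

(** * Coderivatives *)

Lemma coderivativeP (R : realType) (X Y : tvsType R) (F : X -> set Y)
    x0 y0 (ystar : Y -> R^o) (xstar : X -> R^o) : dual ystar ->
  coderivative F x0 y0 ystar xstar <-> dual xstar /\
    forall x y, F x y -> xstar (x - x0) <= ystar (y - y0).
Proof.
move=> dy; split=> [[dx [_ H]]|[dx H]]; split=> //.
  by move=> x y Fxy; rewrite -subr_le0; exact: (H (x, y) Fxy).
split; first by apply: dual_pair_functional => //; exact: dualN.
by move=> [x y] /H; rewrite -subr_le0.
Qed.

Lemma coderivative_sum_superset (R : realType) (X Y : tvsType R)
    (F1 F2 : X -> set Y) x0 y1 y2 (ystar : Y -> R^o) : dual ystar ->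
  minkowski_sum (coderivative F1 x0 y1 ystar) (coderivative F2 x0 y2 ystar)
    `<=` coderivative (map_sum F1 F2) x0 (y1 + y2) ystar.
Proof.
move=> dys _ [x1 + [x2 + <-]].
move=> /coderivativeP-/(_ dys)[dx1 H1] /coderivativeP-/(_ dys)[dx2 H2].
apply/coderivativeP => //; split.
  have := dual_comb 1 dx1 dx2.
  by congr dual; apply/funext => x; rewrite mul1r.
move=> x _ [z1 F1z [z2 F2z <-]]; rewrite opprD addrACA (dualD dys).
by apply: lerD; [exact: H1|exact: H2].
Qed.

Theorem theorem5p2 (R : realType) (X Y : tvsType R) (F1 F2 : X -> set Y)
    (cvxF1 : convex_map F1) (cvxF2 : convex_map F2)
    (qualif : exists (xhat : X) (yhat1 yhat2 : Y),
      gph F1 (xhat, yhat1) /\ qri (gph F2) (xhat, yhat2))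
    (polyF1 : polyhedral F1) :
  forall (xbar : X) (ybar : Y), gph (map_sum F1 F2) (xbar, ybar) ->
  forall ystar : Y -> R^o, dual ystar ->
  forall ybar1 ybar2 : Y, decompositions F1 F2 xbar ybar (ybar1, ybar2) ->
    coderivative (map_sum F1 F2) xbar ybar ystar =
    minkowski_sum (coderivative F1 xbar ybar1 ystar)
                  (coderivative F2 xbar ybar2 ystar).
Proof.
move=> xb yb _ ys dys y1b y2b [/= ybE [F1b F2b]].
apply/seteqP; split=> [xs|]; last first.
  by rewrite ybE; exact: coderivative_sum_superset.
move=> /coderivativeP-/(_ dys)[dxs Hsum].
have [xh [yh1 [yh2 [F1h qrih]]]] := qualif.
have [k [zs [alpha [dzs gphE]]]] := polyF1.
have F1P x y : F1 x y <-> forall i, zs i (x, y) <= alpha i.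
  by rewrite -[F1 x y]/(gph F1 (x, y)) gphE.
(* The cylinder [C] over the graph of [F2] is the preimage of this graph by the
   projection [T], which has the section [s]. *)
pose Z := ((X * Y) * Y)%type.
pose T (z : Z) : X * Y := (z.1.1, z.2).
pose s (w : X * Y) : Z := ((w.1, 0), w.2).
pose C : set Z := T @^-1` gph F2.
have linT : linear T by [].
have lins : linear s.
  move=> a u v; have e : a *: 0 + 0 = 0 :> Y by rewrite scaler0 addr0.
  by rewrite /s -[in LHS]e.
have conts : continuous s.
  apply: continuous_pair; last by move=> w; exact: cvg_snd.
  by apply: continuous_pair => w; [exact: cvg_fst|exact: cvg_cst].
have spA := @affine_space_functionals R Z.
have cC : segment_closed C.
  move=> t z w /andP[t0 t1] Cz Cw.
  exact/set_mem/(cvxF2 (T z) (T w) (Itv01 t0 t1) (mem_set Cz) (mem_set Cw)).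
have riz : relative_interior (@affine_functionals R Z) C ((xh, yh1), yh2).
  apply: (relative_interior_preimage linT lins conts).
    by case.
  exact: qri_relative_interior.
pose g i (z : Z) : R := zs i z.1 - alpha i.
have Ag i : affine_functionals (g i).
  exists (zs i \o fst); last by exists (- alpha i).
  by apply: dual_comp => // z; exact: cvg_fst.
pose f (z : Z) : R := xs (z.1.1 - xb) - ys (z.1.2 - y1b) - ys (z.2 - y2b).
have Af : affine_functionals f.
  exists (pair_functional (pair_functional xs (- ys)) (- ys)).
    by do 2 ![apply: dual_pair_functional => //; last exact: dualN].
  exists (- xs xb + ys y1b + ys y2b); apply/funext => z.
  rewrite /f (dualB dxs) !(dualB dys) /pair_functional/=.
  rewrite -![(- ys) _]/(- ys _); ring.
have gh i : g i ((xh, yh1), yh2) <= 0 by rewrite subr_le0; exact: (F1P _ _).1.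
have fle z : C z -> (forall i, g i z <= 0) -> f z <= 0.
  case: z => [[x y1] y2] /= F2y gz; rewrite /f/=.
  have F1y : F1 x y1 by apply/F1P => i; rewrite -subr_le0; exact: gz.
  rewrite -addrA -opprD -(dualD dys) addrACA -opprD -ybE subr_le0.
  by apply: Hsum; exists y1 => //; exists y2.
have [lam lam0 flam] := polyhedral_multipliers spA cC Ag Af riz gh fle.
pose zeta w : R := \sum_(i < k) lam i * zs i w.
have dzeta : dual zeta by exact: dual_sum.
have zetaE x y : zeta (x, y) = zeta (x, 0) + zeta (0, y).
  by rewrite -(dualD dzeta); congr zeta; congr (_, _); rewrite ?addr0 ?add0r.
(* Complementary slackness at the base point, where [f] is zero and each
   [g i] is nonpositive. *)
have zeta0 : \sum_(i < k) lam i * g i ((xb, y1b), y2b) = 0.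
  apply/le_anti/andP; split.
    apply: sumr_le0 => i _; rewrite mulr_ge0_le0//.
    by rewrite subr_le0; exact: (F1P _ _).1.
  have := flam ((xb, y1b), y2b) F2b.
  by rewrite /f/= !subrr (dual0 dxs) (dual0 dys) !subr0.
have sumE x y1 y2 :
    \sum_(i < k) lam i * g i ((x, y1), y2) = zeta (x - xb, y1 - y1b).
  rewrite -[LHS](subr0 (\sum_(i < k) lam i * g i ((x, y1), y2))).
  rewrite -[X in _ - X = _]zeta0 -sumrB; apply: eq_bigr => i _.
  rewrite -mulrBr; congr (_ * _); rewrite /g/=.
  rewrite -[(x - xb, _)]/((x, y1) - (xb, y1b)) (dualB (dzs i)).
  by ring.
have zeta_le0 x y : F1 x y -> zeta (x - xb, y - y1b) <= 0.
  move=> /F1P F1y; rewrite -(sumE _ _ 0); apply: sumr_le0 => i _.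
  by rewrite mulr_ge0_le0// subr_le0.
have key x y1 y2 : F2 x y2 ->
    xs (x - xb) <= ys (y1 - y1b) + ys (y2 - y2b) + zeta (x - xb, y1 - y1b).
  move=> F2y; have := flam ((x, y1), y2) F2y.
  by rewrite sumE /f/=; lra.
(* In [key] the variable [y1] is arbitrary, so [ys + zeta (0, -)] is a
   nonnegative linear function, hence zero. *)
have ysE y : ys y = - zeta (0, y).
  have ge0 v : 0 <= ys v + zeta (0, v).
    have := key xb (v + y1b) y2b F2b.
    by rewrite !addrK !subrr (dual0 dxs) (dual0 dys) addr0.
  have := ge0 (- y); have := ge0 y.
  have -> : (0, - y) = - (0, y) :> X * Y by congr (_, _); rewrite oppr0.
  by rewrite (dualNz dys) (dualNz dzeta); lra.
have dzX := dual_pairl dzeta.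
exists (fun x => zeta (x, 0)).
  apply/coderivativeP => //; split=> // x y F1y; rewrite ysE.
  by have := zeta_le0 x y F1y; rewrite zetaE; lra.
exists (xs - (fun x => zeta (x, 0))); last first.
  by apply/funext => x; rewrite addrC; exact: subrK.
apply/coderivativeP => //; split.
  have := dual_comb (-1) dzX dxs; congr dual.
  by apply/funext => x; rewrite mulN1r addrC.
move=> x y F2y; have := key x y1b y F2y.
by rewrite subrr (dual0 dys) add0r -lerBlDr.
Qed.
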